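(* For every positive integer $n$ and every odd integer $k\ge 3$, $\tilde{r}(C_k,P_n)\le 3n+50k$.
   Context: The online Ramsey game is played between Builder and Painter on the infinite complete graph $K_{\mathbb N}$. In each round Builder selects a previously unselected edge of $K_{\mathbb N}$ and Painter colors it red or blue. For finite graphs $G_1,G_2$, the game ends as soon as the graph formed by all colored edges contains a red copy of $G_1$ or a blue copy of $G_2$; Builder wants to end the game as soon as possible and Painter wants to delay the end. The online Ramsey number $\tilde{r}(G_1,G_2)$ is the minimum number of rounds within which Builder can guarantee the end of the game, both players playing optimally. $C_k$ denotes the cycle on $k$ vertices and $P_n$ the path on $n$ vertices. *)

(* Defs.v *)
From HB Require Import structures.
From mathcomp Require Import all_boot.

Set Implicit Arguments.
Unset Strict Implicit.
Unset Printing Implicit Defensive.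

Record sgraph := SGraph {
  svertex :> finType;
  sedge : rel svertex;
  sedge_sym : symmetric sedge;
  sedge_irrefl : irreflexive sedge }.

Definition path_rel (n : nat) : rel 'I_n :=
  [rel i j : 'I_n | (j == i.+1 :> nat) || (i == j.+1 :> nat)].

Lemma path_rel_sym n : symmetric (@path_rel n).
Proof. by move=> i j; rewrite /path_rel /= orbC. Qed.

Lemma path_rel_irrefl n : irreflexive (@path_rel n).
Proof. by move=> i; rewrite /path_rel /= orbb; apply/negbTE; rewrite neq_ltn ltnSn. Qed.

(* The path on n vertices, hence with n.-1 edges. *)
Definition path_graph (n : nat) : sgraph :=
  SGraph (@path_rel_sym n) (@path_rel_irrefl n).

(* The conjunct i != j only matters for k = 1: it removes the loop there. *)
Definition cycle_rel (k : nat) : rel 'I_k :=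
  [rel i j : 'I_k | (i != j) &&
    ((j == i.+1 %% k :> nat) || (i == j.+1 %% k :> nat))].

Lemma cycle_rel_sym k : symmetric (@cycle_rel k).
Proof. by move=> i j; rewrite /cycle_rel /= eq_sym orbC. Qed.

Lemma cycle_rel_irrefl k : irreflexive (@cycle_rel k).
Proof. by move=> i; rewrite /cycle_rel /= eqxx. Qed.

(* This is the cycle on k vertices when 3 <= k. *)
Definition cycle_graph (k : nat) : sgraph :=
  SGraph (@cycle_rel_sym k) (@cycle_rel_irrefl k).

Definition color := bool.
Definition red : color := true.
Definition blue : color := false.

(* A position of the game on the complete graph with vertex set nat: the list
   of the edges selected so far, with their colors. An entry (u, v, c) stands
   for the unordered edge {u, v}. *)
Definition position := seq (nat * nat * color).

Definition has_color (s : position) (c : color) : rel nat :=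
  [rel u v | ((u, v, c) \in s) || ((v, u, c) \in s)].

Definition selected (s : position) : rel nat :=
  [rel u v | has_color s red u v || has_color s blue u v].

(* Copies are subgraphs, not necessarily induced. *)
Definition has_copy (s : position) (c : color) (G : sgraph) : Prop :=
  exists2 f : G -> nat, injective f &
    forall x y : G, sedge x y -> has_color s c (f x) (f y).

Definition game_over (G1 G2 : sgraph) (s : position) : Prop :=
  has_copy s red G1 \/ has_copy s blue G2.

(* From position s, Builder can force the end of the game within m more rounds,
   whatever colors Painter chooses. *)
Fixpoint builder_wins (G1 G2 : sgraph) (m : nat) (s : position) : Prop :=
  game_over G1 G2 s \/
  (if m is m'.+1 then
     exists u v : nat, [/\ u != v, ~~ selected s u v &
       forall c : color, builder_wins G1 G2 m' ((u, v, c) :: s)]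
   else False).

(* r is the online Ramsey number of (G1, G2). *)
Definition is_online_ramsey (G1 G2 : sgraph) (r : nat) : Prop :=
  builder_wins G1 G2 r [::] /\
  forall m : nat, builder_wins G1 G2 m [::] -> r <= m.

(* Main.v *)
Require Import Defs.
From mathcomp Require Import all_boot.
From mathcomp Require Import zify.
From Stdlib Require Import Classical.

Set Implicit Arguments.
Unset Strict Implicit.
Unset Printing Implicit Defensive.

(* Builder first races a red path against a blue one until the red path Q has
   linear length in k, at a cost of two rounds per vertex. Then Builder grows two
   blue paths B0 and B1 with ends e0 and e1: a fresh vertex is tested against e0
   and, if the answer is red, against e1, so that vertices of B0 cost one round and
   those of B1 two. If the red graph stays free of triangles, two red answers allow
   Builder to join B0 and B1 into a new B1 without loss, so one of the paths reaches
   length n within 3n + O(k) rounds. If Painter creates a red triangle, it can later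
   be used, together with a piece of Q, to connect any two blue paths in O(k)
   rounds: the triangle destroys the parity obstruction that protects Painter. After
   three triangles, Builder races a red path R against B1 until there are n + O(k)
   vertices altogether, at two rounds per vertex. Vertices of R at distance k - 1
   along R are forced to be blue neighbours, so one more round per vertex turns R
   into at most two blue paths, and the three triangles join these to B0 and B1. *)

(** * Positions and moves *)

(** Positions are compared by the coloured edges they contain, so that order, repetition and
    orientation of entries do not matter. *)
Record ext (s s' : position) : Prop := Ext {
  ext_color : forall c u v, has_color s c u v -> has_color s' c u v }.

Lemma ext_refl s : ext s s.
Proof. by []. Qed.

Lemma ext_trans s2 s1 s3 : ext s1 s2 -> ext s2 s3 -> ext s1 s3.
Proof. by move=> h12 h23; split=> c u v /(ext_color h12) /(ext_color h23). Qed.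

Arguments has_color : simpl never.

Lemma has_colorC s c : symmetric (has_color s c).
Proof. by move=> u v; rewrite /has_color /= orbC. Qed.

Lemma ext_cons e s : ext s (e :: s).
Proof. by split=> c u v /orP[]; rewrite /has_color /= !inE => ->; rewrite !orbT. Qed.

Lemma ext_cons2 e s s' : ext s s' -> ext (e :: s) (e :: s').
Proof.
move=> [hs]; split=> c u v; rewrite /has_color /= !inE.
case/orP=> /orP[-> | h]; rewrite ?orbT //.
  by have := hs c u v; rewrite /has_color /= h /= => /(_ isT)/orP[]->; rewrite !orbT.
by have := hs c u v; rewrite /has_color /= h orbT => /(_ isT)/orP[]->; rewrite !orbT.
Qed.

Lemma has_color_cons u v c s : has_color ((u, v, c) :: s) c u v.
Proof. by rewrite /has_color /= inE eqxx. Qed.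

Lemma ext_cons_known u v c s : has_color s c u v -> ext ((u, v, c) :: s) s.
Proof.
move=> huv; split=> d x y; rewrite /has_color /= !inE.
case/orP=> /orP[/eqP[-> -> ->] | h]; rewrite ?h ?orbT //.
by rewrite has_colorC in huv.
Qed.

Lemma game_over_ext G1 G2 s s' : ext s s' -> game_over G1 G2 s -> game_over G1 G2 s'.
Proof.
by move=> hs [] [f fi fe]; [left | right]; exists f => // x y /fe /(ext_color hs).
Qed.

Lemma builder_wins_over G1 G2 m s : game_over G1 G2 s -> builder_wins G1 G2 m s.
Proof. by case: m => *; left. Qed.

(** When the strategy for [s] asks for an edge already coloured in [s'], Builder skips that round
    and follows the branch of the known colour. *)
Lemma builder_wins_ext G1 G2 m m' s s' :
  ext s s' -> m <= m' -> builder_wins G1 G2 m s -> builder_wins G1 G2 m' s'.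
Proof.
elim: m m' s s' => [|m IH] m' s s' hs hm.
  by move=> [/(game_over_ext hs) /builder_wins_over|].
case: m' hm => // m' hm [/(game_over_ext hs) /builder_wins_over // | [u [v [huv _ hw]]]].
have [/orP[] hc | hsel] := boolP (selected s' u v).
- apply: IH (hw red); last lia.
  exact: ext_trans (ext_cons2 _ hs) (ext_cons_known hc).
- apply: IH (hw blue); last lia.
  exact: ext_trans (ext_cons2 _ hs) (ext_cons_known hc).
right; exists u, v; split=> // c.
by apply: IH (hw c); [exact: ext_cons2 | lia].
Qed.

(** If the edge is already selected, its colour is known and the round is saved. Strategies thus
    never have to check that an edge is new. *)
Lemma builder_wins_test G1 G2 u v m s : u != v ->
  (forall s', ext s s' -> has_color s' red u v -> builder_wins G1 G2 m s') ->
  (forall s', ext s s' -> has_color s' blue u v -> builder_wins G1 G2 m s') ->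
  builder_wins G1 G2 m.+1 s.
Proof.
move=> huv hr hb.
have [/orP[] hc | hsel] := boolP (selected s u v).
- by apply: builder_wins_ext (hr s (@ext_refl s) hc).
- by apply: builder_wins_ext (hb s (@ext_refl s) hc).
right; exists u, v; split=> // -[].
  exact: hr (@ext_cons _ _) (has_color_cons _ _ _ _).
exact: hb (@ext_cons _ _) (has_color_cons _ _ _ _).
Qed.

Lemma builder_wins_reveal G1 G2 (T : seq (nat * nat)) m s :
  all (fun e => e.1 != e.2) T ->
  (forall s', ext s s' -> (forall u v, (u, v) \in T -> selected s' u v) ->
     builder_wins G1 G2 m s') ->
  builder_wins G1 G2 (size T + m) s.
Proof.
elim: T s => [|[u v] T IH] s /=; first by move=> _ /(_ s); apply.
case/andP=> huv hT hw.
have next s1 : ext s s1 -> selected s1 u v -> builder_wins G1 G2 (size T + m) s1.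
  move=> hs1 hsel; apply: IH => // s2 hs2 hall; apply: hw => [|x y].
    exact: ext_trans hs2.
  rewrite inE => /orP[/eqP[-> ->] | /hall //].
  by case/orP: hsel => /(ext_color hs2) hc; apply/orP; [left | right].
by apply: (builder_wins_test huv) => s1 hs1 hc; apply: next => //; rewrite /selected /= hc ?orbT.
Qed.

Lemma builder_wins_classic G1 G2 m s :
  (~ game_over G1 G2 s -> builder_wins G1 G2 m s) -> builder_wins G1 G2 m s.
Proof. by case: (classic (game_over G1 G2 s)) => [h _ | hn]; [exact: builder_wins_over | apply]. Qed.

(** The minimum exists by strong induction, with a classical case split on whether fewer rounds
    suffice. *)
Lemma online_ramsey_le G1 G2 m : builder_wins G1 G2 m [::] ->
  exists2 r, is_online_ramsey G1 G2 r & r <= m.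
Proof.
elim/ltn_ind: m => m IH hm.
case: (classic (exists2 m', m' < m & builder_wins G1 G2 m' [::])) => [[m' lt_m'm hm'] | hmin].
  by have [r hr le_rm'] := IH _ lt_m'm hm'; exists r => //; lia.
exists m => //; split=> // m' hm'; rewrite leqNgt; apply/negP => lt_m'm.
by apply: hmin; exists m'.
Qed.

(** * Cycles, paths and disjointness in terms of vertex lists *)

Lemma cycle_nth (T : eqType) (e : rel T) x0 p i : cycle e p -> i < size p ->
  e (nth x0 p i) (nth x0 p (i.+1 %% size p)).
Proof.
case: p => // x p /= hc; rewrite ltnS => le_ip.
have := pathP x0 hc i; rewrite size_rcons ltnS => /(_ le_ip).
rewrite -rcons_cons nth_rcons /= ltnS le_ip nth_rcons.
case: ltngtP le_ip => // [lt_ip | ->] _; last by rewrite modnn.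
by rewrite modn_small.
Qed.

Lemma red_cycle_over k G2 s (p : seq nat) : uniq p -> size p = k -> cycle (has_color s red) p ->
  game_over (cycle_graph k) G2 s.
Proof.
move=> up sp hc; left; exists (fun i : 'I_k => nth 0 p i) => [i j /eqP|i j].
  by rewrite nth_uniq ?sp // => /eqP /val_inj.
move=> /= /andP[_]; 
have h (a : 'I_k) : has_color s red (nth 0 p a) (nth 0 p (a.+1 %% k)).
  by have := @cycle_nth _ _ 0 _ a hc; rewrite sp ltn_ord; apply.
by case/orP=> /eqP ->; [|rewrite has_colorC]; apply: h.
Qed.

Lemma blue_path_over n G1 s (p : seq nat) : uniq p -> n <= size p -> sorted (has_color s blue) p ->
  game_over G1 (path_graph n) s.
Proof.
move=> up sp hp; right; exists (fun i : 'I_n => nth 0 p i) => [i j /eqP|i j].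
  rewrite nth_uniq ?(leq_trans (ltn_ord _) sp) // => /eqP; exact: val_inj.
have h (a b : 'I_n) : b = a.+1 :> nat -> has_color s blue (nth 0 p a) (nth 0 p b).
  by move=> e; have := ltn_ord b; rewrite e => lt_bn; apply: (sortedP 0 hp); exact: leq_trans lt_bn sp.
by case/orP=> /eqP; [|rewrite has_colorC]; exact: h.
Qed.

Lemma fresh_vertex (l : seq nat) : exists z, z \notin l.
Proof.
exists (sumn l).+1; apply/negP => hz.
suff : (sumn l).+1 <= sumn l by rewrite ltnn.
by elim: l ((sumn l).+1) hz => //= a l IH z; rewrite inE => /orP[/eqP->|/IH]; lia.
Qed.

(** Disjointness of all current paths is kept as [uniq] of one concatenation. Comparing
    multiplicities turns regrouping, reversal and deletion into linear arithmetic. *)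
Lemma uniq_count_le (T : eqType) (p q : seq T) :
  (forall a, count a p <= count a q) -> uniq q -> uniq p.
Proof.
move=> hpq uq; elim: p hpq => //= x p IH hpq.
rewrite IH ?andbT => [|a]; last by have := hpq a; lia.
rewrite -has_pred1 has_count; have := hpq (pred1 x).
by rewrite /= eqxx (count_uniq_mem _ uq); case: (x \in q); lia.
Qed.

Ltac uniq_from H :=
  apply: uniq_count_le H => ?; rewrite /= ?(count_cat, count_rev) /= ?count_cat /=;
  clear; lia.

Ltac eq_lia H :=
  match goal with |- @eq nat _ _ => simpl; clear -H; lia end.

Ltac size_lia :=
  match goal with
  | |- is_true (_ <= _) => idtac
  | |- is_true ((_ <= _) && (_ <= _)) => apply/andP; split
  end;
  repeat match goal with
  | H : is_true (uniq _) |- _ => clear H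
  | H : is_true (sorted _ _) |- _ => clear H
  | H : is_true (has_color _ _ _ _) |- _ => clear H
  end; simpl in *; lia.

Lemma uniq_neq (T : eqType) (u v : T) p : uniq [:: u, v & p] -> u != v.
Proof. by rewrite /= inE negb_or => /andP[/andP[]]. Qed.

Lemma sorted_ext s s' c p : ext s s' -> sorted (has_color s c) p ->
  sorted (has_color s' c) p.
Proof. by move=> hs; apply: sub_sorted => u v; apply: ext_color. Qed.

Lemma sorted_rev_color s c p : sorted (has_color s c) p ->
  sorted (has_color s c) (rev p).
Proof.
rewrite rev_sorted; apply: sub_sorted => u v; by rewrite has_colorC.
Qed.

(** * Growing paths *)

(* Two rounds increase the total length of the paths: Builder joins their end
   vertices b and r, then joins a fresh vertex to b if br is red, to r if br is
   blue. The path whose colour comes twice gains two vertices and the other one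
   loses one; otherwise one path gains the fresh vertex. *)
Lemma path_race G1 G2 (T L N : nat) F s0 :
  2 * N <= T ->
  (forall m s B R, ext s0 s ->
     sorted (has_color s blue) B -> sorted (has_color s red) R ->
     uniq (B ++ R ++ F) -> size R <= L.+1 -> size B + size R <= N.+1 ->
     L <= size R \/ N <= size B + size R ->
     T <= m + 2 * (size B + size R) -> builder_wins G1 G2 m s) ->
  forall m s B R, ext s0 s -> 0 < size B -> 0 < size R ->
     sorted (has_color s blue) B -> sorted (has_color s red) R ->
     uniq (B ++ R ++ F) -> size R <= L.+1 -> size B + size R <= N.+1 ->
     T <= m + 2 * (size B + size R) -> builder_wins G1 G2 m s.
Proof.
move=> hT hstop; elim/ltn_ind => m IH s B R hs B0 R0 hB hR hu hL hN hm.
have [go|] := boolP ((L <= size R) || (N <= size B + size R)).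
  by apply: (hstop m s B R) => //; apply/orP.
rewrite negb_or -!ltnNge => /andP[ltL ltN].
(* The total is below [N], so [2 * N <= T] leaves at least two rounds. *)
case: m IH hm => [|[|m]] IH hm; [lia | lia |].
(* A path that lost its only vertex is restarted from a fresh one. *)
have {}IH s' B' R' : ext s s' ->
    sorted (has_color s' blue) B' -> sorted (has_color s' red) R' ->
    uniq (B' ++ R' ++ F) -> size R' <= (size R).+2 ->
    size B + size R < size B' + size R' <= (size B + size R).+1 ->
    builder_wins G1 G2 m s'.
  move=> hs' hB' hR' hu' hL2 hN'; have hs2 := ext_trans hs hs'.
  case: B' => [|b B'] in hB' hu' hN' *.
    have [z hz] := fresh_vertex (R' ++ F).
    have {}hu' : uniq ([:: z] ++ R' ++ F) by rewrite cons_uniq hz.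
    by apply: (IH m _ s' [:: z] R') => //; size_lia.
  case: R' => [|r R'] in hR' hu' hL2 hN' *.
    have [z hz] := fresh_vertex ((b :: B') ++ F).
    have hu2 : uniq (z :: (b :: B') ++ F) by rewrite cons_uniq hz; exact: hu'.
    apply: (IH m _ s' (b :: B') [:: z]) => //; try size_lia.
    by uniq_from hu2.
  by apply: (IH m _ s' (b :: B') (r :: R')) => //; size_lia.
case: B => [//|b B] in B0 hB hu hN hm ltN IH *.
case: R => [//|r R] in R0 hR hu hL hN hm ltL ltN IH *.
have [z hz] := fresh_vertex ((b :: B) ++ (r :: R) ++ F).
have {}hu : uniq (z :: (b :: B) ++ (r :: R) ++ F) by rewrite cons_uniq hz.
have neq x y : uniq [:: x, y & [::]] -> x != y by exact: uniq_neq.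
apply: (@builder_wins_test _ _ r b); first by apply: neq; uniq_from hu.
  move=> s1 hs1 h1; apply: (@builder_wins_test _ _ z b); first by apply: neq; uniq_from hu.
    move=> s2 hs2 h2; have hs' := ext_trans hs1 hs2.
    apply: (IH s2 B [:: z, b, r & R]); try size_lia; try exact: hs'; try by uniq_from hu.
    - by have /path_sorted := sorted_ext hs' hB.
    - rewrite /= h2 (has_colorC s2) (ext_color hs2) //=.
      exact: (sorted_ext hs' hR).
  move=> s2 hs2 h2; have hs' := ext_trans hs1 hs2.
  apply: (IH s2 [:: z, b & B] (r :: R)); try size_lia; try exact: hs'; try by uniq_from hu.
  - by rewrite /= h2; exact: (sorted_ext hs' hB).
  - exact: (sorted_ext hs' hR).
move=> s1 hs1 h1; apply: (@builder_wins_test _ _ z r); first by apply: neq; uniq_from hu.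
  move=> s2 hs2 h2; have hs' := ext_trans hs1 hs2.
  apply: (IH s2 (b :: B) [:: z, r & R]); try size_lia; try exact: hs'; try by uniq_from hu.
  - exact: (sorted_ext hs' hB).
  - by rewrite /= h2; exact: (sorted_ext hs' hR).
move=> s2 hs2 h2; have hs' := ext_trans hs1 hs2.
apply: (IH s2 [:: z, r, b & B] R); try size_lia; try exact: hs'; try by uniq_from hu.
- rewrite /= h2 (ext_color hs2) //=.
  exact: (sorted_ext hs' hB).
- by have /path_sorted := sorted_ext hs' hR.
Qed.

(* [B0] and [B1] are blue paths whose first vertices [e0] and [e1] are the ends
   at which they grow. In the last two cases, a red reply at [e0] followed by a
   red reply at [e1] is punished by joining the two paths. *)
Definition ladder_state (s : position) (B0 B1 : seq nat) : Prop :=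
  match B0, B1 with
  | _, [::] => False
  | [::], _ => True
  | e0 :: B0', e1 :: _ =>
    [\/ has_color s red e0 e1,
        exists2 p, B0' = [:: p] & has_color s red p e1 | 1 < size B0']
  end.

Lemma sorted_cons2 (T : Type) (e : rel T) x y p :
  e x y -> sorted e (y :: p) -> sorted e [:: x, y & p].
Proof. by move=> /= ->. Qed.

Lemma sorted_behead (T : Type) (e : rel T) x p : sorted e (x :: p) -> sorted e p.
Proof. exact: path_sorted. Qed.

Lemma sorted_rev_cat s c x p y q : has_color s c x y ->
  sorted (has_color s c) (x :: p) -> sorted (has_color s c) (y :: q) ->
  sorted (has_color s c) (rev (x :: p) ++ y :: q).
Proof.
move=> hxy hp hq; have := sorted_rev_color hp; rewrite rev_cons.
case: (rev p) => [|z r] /=; first by rewrite hxy.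
by rewrite cat_path last_rcons /= hxy => ->.
Qed.

(** The potential [m + size B0 + 2 * size B1] does not drop before a triangle appears. Joining moves
    the vertices of [B0] from weight 1 to weight 2, which pays for its three rounds once [B0] has
    three vertices. A triangle costs at most 7: four rounds and one vertex of each path. *)
Lemma ladder n G1 (T : nat) F s0 : 3 * n < T ->
  (forall m s B0 B1 x y z, ext s0 s ->
     sorted (has_color s blue) B0 -> sorted (has_color s blue) B1 ->
     uniq ([:: x; y; z] ++ B0 ++ B1 ++ F) ->
     has_color s red x y -> has_color s red y z -> has_color s red x z ->
     T <= m + size B0 + 2 * size B1 + 8 -> builder_wins G1 (path_graph n) m s) ->
  forall m s B0 B1, ext s0 s -> ladder_state s B0 B1 ->
     sorted (has_color s blue) B0 -> sorted (has_color s blue) B1 ->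
     uniq (B0 ++ B1 ++ F) -> T <= m + size B0 + 2 * size B1 ->
     builder_wins G1 (path_graph n) m s.
Proof.
move=> hT htri; elim/ltn_ind => m IH s B0 B1 hs st h0 h1 hu hm.
apply: builder_wins_classic => hover.
have lt0 : size B0 < n.
  rewrite ltnNge; apply/negP => h; apply: hover; apply: (@blue_path_over n G1 s _ _ h h0).
  by uniq_from hu.
have lt1 : size B1 < n.
  rewrite ltnNge; apply/negP => h; apply: hover; apply: (@blue_path_over n G1 s _ _ h h1).
  by uniq_from hu.
(* Four rounds are the longest turn below. *)
have {lt0 lt1 hover} hm4 : 4 <= m by lia.
case: m hm4 IH hm => [|[|[|[|m]]]] // _ IH hm.
have test := @builder_wins_test G1 (path_graph n).
have [v hv] := fresh_vertex (B0 ++ B1 ++ F).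
have {hv}hu : uniq (v :: B0 ++ B1 ++ F) by rewrite cons_uniq hv.
case: B1 => [|e1 B1] in st h1 hu hm *; first by case: B0 {h0 hu hm} st.
have neq x y : uniq [:: x; y] -> x != y by exact: uniq_neq.
case: B0 => [|e0 B0] in st h0 hu hm *.
  apply: (test v e1); first by apply: neq; uniq_from hu.
    move=> s1 hs1 c1; apply: (IH _ _ s1 [:: v] (e1 :: B1)) => //; try size_lia.
    - exact: ext_trans hs hs1.
    - by constructor 1.
    - exact: sorted_ext hs1 h1.
  move=> s1 hs1 c1; apply: (IH _ _ s1 [::] [:: v, e1 & B1]) => //; try size_lia.
  - exact: ext_trans hs hs1.
  - by apply: sorted_cons2 c1 _; exact: sorted_ext hs1 h1.
have hue : e0 != e1 by apply: neq; uniq_from hu.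
apply: (test v e0); first by apply: neq; uniq_from hu.
  move=> s1 hs1 c1; apply: (test v e1); first by apply: neq; uniq_from hu.
    move=> s2 hs2 c2; have hs12 := ext_trans hs1 hs2.
    case: st => [c3 | [p eB0 c3] | B0long].
    - apply: (htri _ s2 B0 B1 v e0 e1) => //; try size_lia.
      + exact: ext_trans hs hs12.
      + exact: sorted_behead (sorted_ext hs12 h0).
      + exact: sorted_behead (sorted_ext hs12 h1).
      + by uniq_from hu.
      + exact: ext_color hs2 _ _ _ c1.
      + exact: ext_color hs12 _ _ _ c3.
    - subst B0; apply: (test e0 e1) => // s3 hs3 c4; have hs13 := ext_trans hs12 hs3.
        apply: (htri _ s3 [:: p] B1 v e0 e1) => //; try size_lia.
        + exact: ext_trans hs hs13.
        + exact: sorted_behead (sorted_ext hs13 h1).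
        + by uniq_from hu.
        + exact: ext_color (ext_trans hs2 hs3) _ _ _ c1.
        + exact: ext_color hs3 _ _ _ c2.
      (* Joining a [B0] of two vertices gains only 2 for three rounds. A fourth round either adds
         [v] to the joined path, for a gain of 4, or closes the triangle [v], [p], [e1]. *)
      apply: (test v p); first by apply: neq; uniq_from hu.
        move=> s4 hs4 c5; have hs14 := ext_trans hs13 hs4.
        apply: (htri _ s4 [:: e0] B1 v p e1) => //; try size_lia.
        + exact: ext_trans hs hs14.
        + exact: sorted_behead (sorted_ext hs14 h1).
        + by uniq_from hu.
        + exact: ext_color hs14 _ _ _ c3.
        + exact: ext_color (ext_trans hs3 hs4) _ _ _ c2.
      move=> s4 hs4 c5; have hs14 := ext_trans hs13 hs4.
      apply: (IH _ _ s4 [::] [:: v, p, e0, e1 & B1]) => //; try size_lia.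
      + exact: ext_trans hs hs14.
      + apply: sorted_cons2 c5 _; apply: sorted_cons2.
          by rewrite has_colorC; case/andP: (sorted_ext hs14 h0).
        apply: sorted_cons2 (ext_color hs4 c4) _; exact: sorted_ext hs14 h1.
      + by uniq_from hu.
    - apply: (test e0 e1) => // s3 hs3 c4; have hs13 := ext_trans hs12 hs3.
        apply: (htri _ s3 B0 B1 v e0 e1) => //; try size_lia.
        + exact: ext_trans hs hs13.
        + exact: sorted_behead (sorted_ext hs13 h0).
        + exact: sorted_behead (sorted_ext hs13 h1).
        + by uniq_from hu.
        + exact: ext_color (ext_trans hs2 hs3) _ _ _ c1.
        + exact: ext_color hs3 _ _ _ c2.
      apply: (IH _ _ s3 [::] (rev (e0 :: B0) ++ e1 :: B1)) => //; try size_lia.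
      + exact: ext_trans hs hs13.
      + by case: (rev (e0 :: B0)).
      + exact: sorted_rev_cat c4 (sorted_ext hs13 h0) (sorted_ext hs13 h1).
      + by uniq_from hu.
      + by rewrite /= size_cat size_rev; size_lia.
  move=> s2 hs2 c2; have hs12 := ext_trans hs1 hs2.
  apply: (IH _ _ s2 (e0 :: B0) [:: v, e1 & B1]) => //; try size_lia.
  - exact: ext_trans hs hs12.
  - by constructor 1; rewrite has_colorC; exact: ext_color hs2 _ _ _ c1.
  - exact: sorted_ext hs12 h0.
  - by apply: sorted_cons2 c2 _; exact: sorted_ext hs12 h1.
  - by uniq_from hu.
move=> s1 hs1 c1.
apply: (IH _ _ s1 [:: v, e0 & B0] (e1 :: B1)) => //; try size_lia.
- exact: ext_trans hs hs1.
- case: st => [c3 | [p -> c3] | B0long]; try by constructor 3; size_lia.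
  case: B0 {h0 hu hm} => [|? ?]; last by constructor 3.
  by constructor 2; exists e0; last exact: ext_color hs1 _ _ _ c3.
- by apply: sorted_cons2 c1 _; exact: sorted_ext hs1 h0.
- exact: sorted_ext hs1 h1.
Qed.

(** * Joining blue paths with a red triangle *)

Lemma count_sub (p q : seq nat) a :
  uniq p -> {subset p <= q} -> count a p <= count a q.
Proof.
move=> up hpq; rewrite -!size_filter uniq_leq_size ?filter_uniq // => x.
by rewrite !mem_filter => /andP[-> /hpq].
Qed.

Lemma last_iota a d : last a (iota a.+1 d) = a + d.
Proof. by elim: d a => [|d IH] a /=; rewrite ?addn0 // IH addSnnS. Qed.

Lemma sorted_map_nth (T : Type) (e : rel T) x0 p a d : sorted e p ->
  a + d <= size p -> sorted e [seq nth x0 p i | i <- iota a d].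
Proof.
move=> /(sortedP x0) hp had; apply/(sortedP x0) => i; rewrite size_map size_iota => hi.
rewrite !(nth_map 0) ?size_iota ?nth_iota; try lia.
by rewrite addnS; apply: hp; lia.
Qed.

Lemma uniq_map_nth (T : eqType) x0 (p : seq T) r : uniq p -> uniq r ->
  all (fun i => i < size p) r -> uniq [seq nth x0 p i | i <- r].
Proof.
move=> up ur /allP hr; rewrite map_inj_in_uniq // => i j /hr hi /hr hj /eqP.
by rewrite nth_uniq // => /eqP.
Qed.

(* The odd cycle behind the contradiction is A 0, B 0, A 1, B 1, ..., A h
   (or the same with B and C): along it, membership alternates. *)
Lemma zigzag h (A B C : pred nat) :
  (forall t, t <= h -> A t || B t) -> (forall t, t < h -> B t || C t) ->
  (forall t, t < h -> ~~ (A t.+1 && B t)) -> (forall t, t < h -> ~~ (B t.+1 && C t)) ->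
  ~~ (A 0 && A h) -> ~~ (B 0 && B h) -> False.
Proof.
move=> AB BC nAB nBC nA nB.
have down (X Y : pred nat) : (forall t, t < h -> X t || Y t) ->
    (forall t, t < h -> ~~ (X t.+1 && Y t)) -> X h -> X 0.
  move=> XY nXY; have: h <= h by [].
  elim: {-2}h => // t IH lt_th hX; apply: IH; first by lia.
  by have := nXY _ lt_th; rewrite hX /=; have := XY _ lt_th; case: (X t) => //= ->.
have [hA|hA] := boolP (A h).
  by move: nA; rewrite hA (down A B) // => t lt_th; apply: AB; lia.
have hB : B h by have := AB h (leqnn h); rewrite (negPf hA).
by move: nB; rewrite hB (down B C).
Qed.

(** The progressions [A t = 2t+1], [B t = 2h+2+2t] and [C t = 4h+3+2t]. With [k = 2h+3], the
    distance is [k-2] from [A t] to [B t] and from [B t] to [C t], [k-4] from [A (t+1)] to [B t] and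
    from [B (t+1)] to [C t], and [k-3] from [A 0] to [A h] and from [B 0] to [B h]. *)
Definition probes h : seq nat :=
  [seq t.*2.+1 | t <- iota 0 h.+1] ++ [seq h.*2.+2 + t.*2 | t <- iota 0 h.+1] ++
  [seq h.*2.*2.+3 + t.*2 | t <- iota 0 h].

Lemma size_probes h : size (probes h) = 3 * h + 2.
Proof. by rewrite !size_cat !size_map !size_iota; lia. Qed.

Lemma probes_ub h i : 0 < h -> i \in probes h -> i < 6 * h + 2.
Proof.
move=> h0; rewrite !mem_cat => /or3P[] /mapP[t]; rewrite mem_iota => ht ->; lia.
Qed.

Lemma probes_zigzag h (N : pred nat) : 0 < h ->
  (forall i, i \in probes h -> i + h.*2.+1 \in probes h -> N i || N (i + h.*2.+1)) ->
  (forall i, i \in probes h -> i + h.*2 \in probes h -> ~~ (N i && N (i + h.*2))) ->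
  (forall i, i \in probes h -> i + h.*2.-1 \in probes h -> ~~ (N i && N (i + h.*2.-1))) ->
  False.
Proof.
move=> h0 h1 h2 h3.
have pA t : t <= h -> t.*2.+1 \in probes h.
  by move=> ht; rewrite !mem_cat map_f // mem_iota; lia.
have pB t : t <= h -> h.*2.+2 + t.*2 \in probes h.
  by move=> ht; rewrite !mem_cat (map_f (fun t => h.*2.+2 + t.*2)) ?orbT // mem_iota; lia.
have pC t : t < h -> h.*2.*2.+3 + t.*2 \in probes h.
  by move=> ht; rewrite !mem_cat (map_f (fun t => h.*2.*2.+3 + t.*2)) ?orbT // mem_iota; lia.
apply: (@zigzag h (fun t => N t.*2.+1) (fun t => N (h.*2.+2 + t.*2))
  (fun t => N (h.*2.*2.+3 + t.*2))) => [t ht|t ht|t ht|t ht||].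
- have e : h.*2.+2 + t.*2 = t.*2.+1 + h.*2.+1 by lia.
  by rewrite e h1 -?e ?pA ?pB.
- have e : h.*2.*2.+3 + t.*2 = h.*2.+2 + t.*2 + h.*2.+1 by lia.
  by rewrite e h1 -?e ?pC ?pB //; lia.
- have e : t.+1.*2.+1 + h.*2.-1 = h.*2.+2 + t.*2 by lia.
  by rewrite -e h3 ?e ?pA ?pB //; lia.
- have e : h.*2.+2 + t.+1.*2 + h.*2.-1 = h.*2.*2.+3 + t.*2 by lia.
  by rewrite -e h3 ?e ?pC ?pB //; lia.
- have e : h.*2.+1 = 0.*2.+1 + h.*2 by lia.
  by rewrite e h2 -?e ?pA.
have e : h.*2.+2 + h.*2 = h.*2.+2 + 0.*2 + h.*2 by lia.
by rewrite e h2 -?e ?pB.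
Qed.

(** The red cycle follows [Q] from index [a] to [a + d] and returns outside [Q] through [x] and
    [p]. *)
Lemma red_detour_over k G2 s Q a d x p : sorted (has_color s red) Q ->
  uniq (x :: p ++ Q) -> a + d < size Q -> d.+1 + (size p).+1 = k ->
  has_color s red (nth 0 Q (a + d)) x -> path (has_color s red) x p ->
  has_color s red (last x p) (nth 0 Q a) -> game_over (cycle_graph k) G2 s.
Proof.
move=> hQ hu had hk h1 h2 h3.
have uQ : uniq Q by uniq_from hu.
pose r := [seq nth 0 Q i | i <- iota a d.+1].
have hr : sorted (has_color s red) r by apply: (sorted_map_nth 0 hQ); lia.
have sr : size r = d.+1 by rewrite size_map size_iota.
have ur : uniq r.
  by apply: uniq_map_nth; rewrite ?iota_uniq //; apply/allP => i; rewrite mem_iota => hi; apply: leq_trans had; lia.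
have subr : {subset r <= Q}.
  move=> v /mapP[i]; rewrite mem_iota => hi ->; apply: mem_nth; apply: leq_trans had; clear -hi; lia.
apply: (@red_cycle_over _ _ _ (r ++ x :: p)).
- apply: uniq_count_le hu => b; rewrite -cat_cons !count_cat addnC leq_add2l.
  exact: count_sub.
- by rewrite size_cat sr.
have lastr : last (nth 0 Q a) (behead r) = nth 0 Q (a + d).
  by rewrite /= (last_map (nth 0 Q)) last_iota.
have: r = nth 0 Q a :: behead r by [].
move: (behead r) lastr => r' lastr er; move: hr; rewrite er => /= hr'.
by rewrite /= rcons_cat rcons_cons cat_path /= rcons_path hr' lastr h1 h2 h3.
Qed.

(* [e] is red to both [x] and [y]. If no blue connection from [e] to [f] passes
   through [Q] or through [Q], one of [x] and [y], and [Q] again, then the set N of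
   probed vertices of [Q] that are blue to [f] (or to [e]) meets every pair of
   probes at distance k - 2 and has no two elements at distance k - 3 or k - 4. *)
Lemma blue_connection h G2 s Q e f x y : 0 < h ->
  ~ game_over (cycle_graph h.*2.+3) G2 s ->
  sorted (has_color s red) Q -> 6 * h + 2 <= size Q ->
  uniq ([:: e; f; x; y] ++ Q) ->
  has_color s red e x -> has_color s red e y -> has_color s red x y ->
  {in [:: e; f; x; y] & probes h, forall u i, selected s u (nth 0 Q i)} ->
  exists2 l, path (has_color s blue) e (rcons l f) &
    uniq l /\ {subset l <= [:: x; y] ++ Q}.
Proof.
move=> h0 hover hQ sQ hu ex ey xy hsel.
pose N u i := has_color s blue u (nth 0 Q i).
have uQ : uniq Q by uniq_from hu.
have lt_Q i : i \in probes h -> i < size Q.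
  by move=> hi; apply: leq_trans sQ; exact: probes_ub.
have selN u i : u \in [:: e; f; x; y] -> i \in probes h -> ~~ N u i ->
    has_color s red u (nth 0 Q i).
  by move=> hu' hi; have := hsel u i hu' hi; rewrite /selected /= /N => /orP[]// ->.
have inQ i : i \in probes h -> nth 0 Q i \in Q by move=> /lt_Q hi; rewrite mem_nth.
have [/hasP[i hi /andP[Nei Nfi]] | /hasPn hef] :=
    boolP (has (fun i => N e i && N f i) (probes h)).
  exists [:: nth 0 Q i]; first by rewrite /= [has_color _ _ e _]Nei has_colorC [has_color _ _ f _]Nfi.
  by split=> // v; rewrite inE => /eqP ->; rewrite mem_cat inQ ?orbT.
(* The two probes on either side of [w] differ, since no probe is blue to both [e] and [f]. *)
have via w : w \in [:: x; y] -> has (fun i => N e i && N w i) (probes h) ->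
    has (fun i => N f i && N w i) (probes h) ->
    exists2 l, path (has_color s blue) e (rcons l f) &
      uniq l /\ {subset l <= [:: x; y] ++ Q}.
  move=> hw /hasP[a ha /andP[Nea Nwa]] /hasP[b hb /andP[Nfb Nwb]].
  exists [:: nth 0 Q a; w; nth 0 Q b].
    apply/and5P; split=> //.
      by rewrite has_colorC.
    by rewrite has_colorC.
  have wQ : w \notin Q.
    move: hu hw; rewrite /= !inE => /and5P[_ _ h3 h4 _] /orP[] /eqP ->; last by [].
    by move: h3; rewrite negb_or => /andP[].
  split=> [|v].
    rewrite /= !inE !negb_or nth_uniq ?lt_Q // andbT.
    have -> : nth 0 Q a != w by apply: contra wQ => /eqP <-; rewrite inQ.
    have -> : w != nth 0 Q b by apply: contra wQ => /eqP ->; rewrite inQ.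
    rewrite andbT /=; apply/eqP => eab; subst b.
    by have := hef a ha; rewrite Nea Nfb.
  by rewrite mem_cat 2!inE => /or3P[/eqP-> | /eqP-> | ]; rewrite ?inQ ?orbT ?hw //
    inE => /eqP->; rewrite inQ ?orbT.
have eI : e \in [:: e; f; x; y] by rewrite !inE eqxx.
have fI : f \in [:: e; f; x; y] by rewrite !inE eqxx ?orbT.
have xI : x \in [:: e; f; x; y] by rewrite !inE eqxx ?orbT.
have yI : y \in [:: e; f; x; y] by rewrite !inE eqxx ?orbT.
pose R := has_color s red.
have RC : symmetric R by exact: has_colorC.
have detour i d u p : i \in probes h -> i + d \in probes h ->
    uniq (u :: p ++ Q) -> d.+1 + (size p).+1 = h.*2.+3 ->
    R u (nth 0 Q (i + d)) -> path R u p -> R (last u p) (nth 0 Q i) -> False.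
  move=> hi hd hup sp h1 h2 h3; apply: hover.
  apply: (@red_detour_over _ G2 s Q i d u p hQ hup _ sp _ h2 h3); first exact: lt_Q.
  by rewrite has_colorC.
have redE i : i \in probes h -> N f i -> R e (nth 0 Q i).
  by move=> hi Nfi; apply: selN => //; have := hef i hi; rewrite Nfi andbT.
(* If [w] and [f] share no blue probe, every probe blue to [f] is red to [e] and [w]. At distances
   [k-2], [k-3] and [k-4], red cycles would close through [f], through [w], [e], and through [w],
   [w'], [e]. *)
have good w w' : w \in [:: e; f; x; y] -> uniq [:: w, w', e & Q] ->
    R e w -> R e w' -> R w w' ->
    ~~ has (fun i => N f i && N w i) (probes h) -> False.
  move=> wI huw ew ew' ww' /hasPn hw.
  have redW i : i \in probes h -> N f i -> R w (nth 0 Q i).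
    by move=> hi Nfi; apply: selN => //; have := hw i hi; rewrite Nfi.
  apply: (@probes_zigzag h (N f)) => // i hi hd.
  - case: (boolP (N f i)) => //= n1; case: (boolP (N f _)) => //= n2.
    exfalso; apply: (detour i h.*2.+1 f [::]) => //; try eq_lia h0.
    + by uniq_from hu.
    + exact: selN.
    + exact: selN.
  - apply/negP => /andP[n1 n2]; apply: (detour i h.*2 w [:: e]) => //; try eq_lia h0.
    + by uniq_from huw.
    + exact: redW.
    + by rewrite /= RC ew.
    + exact: redE.
  - apply/negP => /andP[n1 n2]; apply: (detour i h.*2.-1 w [:: w'; e]) => //; try eq_lia h0.
    + exact: redW.
    + by rewrite /= ww' RC ew'.
    + exact: redE.
have [hx|hx] := boolP (has (fun i => N f i && N x i) (probes h)); last first.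
  by exfalso; apply: (good x y) => //; uniq_from hu.
have [hy|hy] := boolP (has (fun i => N f i && N y i) (probes h)); last first.
  by exfalso; apply: (good y x) => //; [uniq_from hu | rewrite RC].
have [hx'|/hasPn hx'] := boolP (has (fun i => N e i && N x i) (probes h)).
  by apply: (via x); rewrite ?inE ?eqxx.
have [hy'|/hasPn hy'] := boolP (has (fun i => N e i && N y i) (probes h)).
  by apply: (via y); rewrite ?inE ?eqxx ?orbT.
exfalso.
(* The same argument for [N e]: the cycles now close through [e], through [x], [y], and through [x],
   [e], [y]. *)
have redX i : i \in probes h -> N e i -> R x (nth 0 Q i).
  by move=> hi Nei; apply: selN => //; have := hx' i hi; rewrite Nei.
have redY i : i \in probes h -> N e i -> R y (nth 0 Q i).
  by move=> hi Nei; apply: selN => //; have := hy' i hi; rewrite Nei.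
apply: (@probes_zigzag h (N e)) => // i hi hd.
- case: (boolP (N e i)) => //= n1; case: (boolP (N e _)) => //= n2.
  exfalso; apply: (detour i h.*2.+1 e [::]) => //; try eq_lia h0.
  + by uniq_from hu.
  + exact: selN.
  + exact: selN.
- apply/negP => /andP[n1 n2]; apply: (detour i h.*2 x [:: y]) => //; try eq_lia h0.
  + by uniq_from hu.
  + exact: redX.
  + by rewrite /= andbT.
  + exact: redY.
apply/negP => /andP[n1 n2]; apply: (detour i h.*2.-1 x [:: e; y]) => //; try eq_lia h0.
- by uniq_from hu.
- exact: redX.
- by rewrite /= /R (has_colorC s red x) ex ey.
exact: redY.
Qed.

Ltac subset_tac :=
  let v := fresh in
  move=> v; rewrite !(mem_cat, inE, mem_rev);
  repeat case/orP; move=> ->; rewrite ?orbT.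

Lemma sorted_bridge s c x p l y q : path (has_color s c) x (rcons l y) ->
  sorted (has_color s c) (x :: p) -> sorted (has_color s c) (y :: q) ->
  sorted (has_color s c) (rev (x :: p) ++ l ++ y :: q).
Proof.
move=> hl hp hq.
have hlq : path (has_color s c) x (l ++ y :: q).
  by move: hl; rewrite -cats1 !cat_path /= andbT => /andP[-> ->].
case: (l ++ y :: q) hlq => [|z r] /=; first by move=> _; rewrite cats0; exact: sorted_rev_color.
by case/andP=> hxz hr; exact: sorted_rev_cat.
Qed.

(** The [12 * h + 8] rounds test four vertices against [3 * h + 2] probes. The connection found is
    inserted between the two paths, which lose no vertex. *)
Lemma join_attached h G2 m s Pe Pf e f x y Q : 0 < h ->
  sorted (has_color s blue) (e :: Pe) -> sorted (has_color s blue) (f :: Pf) ->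
  sorted (has_color s red) Q -> 6 * h + 2 <= size Q ->
  uniq ((e :: Pe) ++ (f :: Pf) ++ [:: x; y] ++ Q) ->
  has_color s red e x -> has_color s red e y -> has_color s red x y ->
  (forall s' P, ext s s' -> sorted (has_color s' blue) P -> uniq P ->
     {subset P <= (e :: Pe) ++ (f :: Pf) ++ [:: x; y] ++ Q} ->
     size Pe + size Pf + 2 <= size P ->
     builder_wins (cycle_graph h.*2.+3) G2 m s') ->
  builder_wins (cycle_graph h.*2.+3) G2 (12 * h + 8 + m) s.
Proof.
move=> h0 hPe hPf hQ sQ hu ex ey xy hw.
pose T := [seq (u, nth 0 Q i) | u <- [:: e; f; x; y], i <- probes h].
have -> : 12 * h + 8 = size T by rewrite size_allpairs size_probes /=; lia.
have inQ i : i \in probes h -> nth 0 Q i \in Q.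
  by move=> /(probes_ub h0) hi; rewrite mem_nth //; apply: leq_trans sQ.
have hu4 : uniq ([:: e; f; x; y] ++ Q) by uniq_from hu.
apply: builder_wins_reveal => [|s' hs' hT].
  apply/allP => _ /allpairsP[[u i] /= [hu' hi ->]] /=.
  apply/eqP => euq; move: hu4; rewrite cat_uniq => /and3P[_ /hasP[]].
  by exists u; rewrite // euq inQ.
apply: builder_wins_classic => hover.
have [||||l hl [ul sl]] := @blue_connection h G2 s' Q e f x y h0 hover (sorted_ext hs' hQ) sQ hu4.
- exact: ext_color hs' _ _ _ ex.
- exact: ext_color hs' _ _ _ ey.
- exact: ext_color hs' _ _ _ xy.
- by move=> u i hu' hi; apply: hT; apply/allpairsP; exists (u, i).
apply: (hw s' (rev (e :: Pe) ++ l ++ f :: Pf)) => //.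
- exact: sorted_bridge (sorted_ext hs' hPe) (sorted_ext hs' hPf).
- apply: uniq_count_le hu => a; have := count_sub a ul sl.
  by rewrite !count_cat count_rev /=; clear; lia.
- move=> v; rewrite !mem_cat mem_rev => /or3P[->|/sl|->]; rewrite ?orbT //.
  by rewrite mem_cat => /orP[] ->; rewrite ?orbT.
by rewrite !size_cat size_rev /=; clear; lia.
Qed.

(** Six rounds test both ends against the triangle. A triangle vertex blue to both ends joins the
    paths. Otherwise each is red to some end, so one end is red to two of them and [join_attached]
    applies. *)
Lemma join_paths h G2 m s P0 P1 x y z Q : 0 < h ->
  sorted (has_color s blue) P0 -> sorted (has_color s blue) P1 ->
  sorted (has_color s red) Q -> 6 * h + 2 <= size Q ->
  uniq (P0 ++ P1 ++ [:: x; y; z] ++ Q) ->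
  has_color s red x y -> has_color s red y z -> has_color s red x z ->
  (forall s' P, ext s s' -> sorted (has_color s' blue) P -> uniq P ->
     {subset P <= P0 ++ P1 ++ [:: x; y; z] ++ Q} ->
     size P0 + size P1 <= size P ->
     builder_wins (cycle_graph h.*2.+3) G2 m s') ->
  builder_wins (cycle_graph h.*2.+3) G2 (12 * h + 14 + m) s.
Proof.
move=> h0 hP0 hP1 hQ sQ hu xy yz xz hw.
have leW : m <= 12 * h + 14 + m by lia.
case: P0 => [|e0 P0] in hP0 hu hw *.
  apply: (builder_wins_ext (ext_refl s) leW); apply: (hw s P1) => //.
    by uniq_from hu.
  by subset_tac.
case: P1 => [|e1 P1] in hP1 hu hw *.
  apply: (builder_wins_ext (ext_refl s) leW); apply: (hw s (e0 :: P0)) => //.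
  - by uniq_from hu.
  - by subset_tac.
  by rewrite /=; clear; lia.
pose T := [seq (u, v) | u <- [:: e0; e1], v <- [:: x; y; z]].
have -> : 12 * h + 14 + m = size T + (12 * h + 8 + m) by rewrite /=; clear; lia.
have hu5 : uniq ([:: e0; e1] ++ [:: x; y; z]) by uniq_from hu.
apply: builder_wins_reveal => [|s' hs' hT].
  apply/allP => _ /allpairsP[[u v] /= [hu' hv ->]] /=.
  apply/eqP => euv; move: hu5; rewrite cat_uniq => /and3P[_ /hasP[]].
  by exists v => //; rewrite -euv.
have sel u v : u \in [:: e0; e1] -> v \in [:: x; y; z] -> selected s' u v.
  by move=> hu' hv; apply: hT; apply/allpairsP; exists (u, v).
have hP0' := sorted_ext hs' hP0; have hP1' := sorted_ext hs' hP1.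
have [/hasP[w hwI /andP[b0 b1]] | /hasPn nob] :=
    boolP (has (fun w => has_color s' blue e0 w && has_color s' blue e1 w) [:: x; y; z]).
  have leW' : m <= 12 * h + 8 + m by clear; lia.
  apply: (builder_wins_ext (ext_refl s') leW').
  have uw : uniq (w :: (e0 :: P0) ++ e1 :: P1).
    by move: hwI; rewrite !inE => /or3P[] /eqP ->; uniq_from hu.
  apply: (hw s' (rev (e0 :: P0) ++ [:: w] ++ e1 :: P1)) => //.
  - by apply: sorted_bridge => //=; rewrite b0 has_colorC b1.
  - by uniq_from uw.
  - move=> v; rewrite !mem_cat mem_rev => /or3P[->|hv|->]; rewrite ?orbT //.
    by move: hv; rewrite inE => /eqP ->; rewrite hwI ?orbT.
  by rewrite !size_cat size_rev /=; clear; lia.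
have rd w : w \in [:: x; y; z] -> has_color s' red e0 w || has_color s' red e1 w.
  move=> hwI; have := nob w hwI.
  have e1I : e1 \in [:: e0; e1] by rewrite !inE eqxx orbT.
  have := sel e0 w (mem_head _ _) hwI; have := sel e1 w e1I hwI.
  rewrite /selected /=.
  by case: (has_color s' red e0 w); case: (has_color s' red e1 w) => //= -> ->.
have colC c u v : has_color s c u v -> has_color s' c v u.
  by rewrite has_colorC; exact: ext_color.
have hQ' := sorted_ext hs' hQ.
have use0 u v : has_color s' red e0 u -> has_color s' red e0 v -> has_color s' red u v ->
    uniq ((e0 :: P0) ++ (e1 :: P1) ++ [:: u; v] ++ Q) ->
    {subset [:: u; v] <= [:: x; y; z]} ->
    builder_wins (cycle_graph h.*2.+3) G2 (12 * h + 8 + m) s'.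
  move=> eu ev uv huv sub; apply: (join_attached h0 hP0' hP1' hQ' sQ huv) => // s2 P hs2 hP uP sP lP.
  apply: (hw s2 P) => //; [exact: ext_trans hs2 | | by rewrite /=; clear -lP; lia].
  move=> v' /sP; rewrite !mem_cat => /or4P[->|->|hv|->]; rewrite ?orbT //.
  by rewrite (sub v' hv) ?orbT.
have use1 u v : has_color s' red e1 u -> has_color s' red e1 v -> has_color s' red u v ->
    uniq ((e0 :: P0) ++ (e1 :: P1) ++ [:: u; v] ++ Q) ->
    {subset [:: u; v] <= [:: x; y; z]} ->
    builder_wins (cycle_graph h.*2.+3) G2 (12 * h + 8 + m) s'.
  move=> eu ev uv huv sub; have huv' : uniq ((e1 :: P1) ++ (e0 :: P0) ++ [:: u; v] ++ Q) by uniq_from huv.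
  apply: (join_attached h0 hP1' hP0' hQ' sQ huv') => // s2 P hs2 hP uP sP lP.
  apply: (hw s2 P) => //; [exact: ext_trans hs2 | | by rewrite /=; clear -lP; lia].
  move=> v' /sP; rewrite !mem_cat => /or4P[->|->|hv|->]; rewrite ?orbT //.
  by rewrite (sub v' hv) ?orbT.
have xI : x \in [:: x; y; z] by rewrite !inE eqxx.
have yI : y \in [:: x; y; z] by rewrite !inE eqxx ?orbT.
have zI : z \in [:: x; y; z] by rewrite !inE eqxx ?orbT.
have xy' := ext_color hs' xy; have yz' := ext_color hs' yz; have xz' := ext_color hs' xz.
case/orP: (rd x xI) => hx; case/orP: (rd y yI) => hy.
- by apply: (use0 x y) => //; [uniq_from hu | subset_tac].
- case/orP: (rd z zI) => hz.
    by apply: (use0 x z) => //; [uniq_from hu | subset_tac].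
  by apply: (use1 y z) => //; [uniq_from hu | subset_tac].
- case/orP: (rd z zI) => hz.
    by apply: (use0 y z) => //; [uniq_from hu | subset_tac].
  by apply: (use1 x z) => //; [uniq_from hu | subset_tac].
- by apply: (use1 x y) => //; [uniq_from hu | subset_tac].
Qed.

(** * Turning a red path into blue paths *)

Lemma red_chord_over K G2 s (f : nat -> nat) :
  (forall i, i < K -> has_color s red (f i) (f i.+1)) ->
  has_color s red (f K) (f 0) ->
  {in gtn K.+1 &, injective f} -> game_over (cycle_graph K.+1) G2 s.
Proof.
move=> hf hK finj; apply: (@red_cycle_over _ _ _ (mkseq f K.+1)).
- rewrite map_inj_in_uniq ?iota_uniq // => i j; rewrite !mem_iota => hi hj.
  by apply: finj.
- by rewrite size_mkseq.
have hs : sorted (has_color s red) (mkseq f K.+1).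
  apply/(sortedP 0) => i; rewrite size_mkseq => hi.
  by rewrite !nth_mkseq //; [exact: hf | exact: ltnW].
by move: hs; rewrite /= rcons_path (last_map f) last_iota hK andbT.
Qed.

Lemma sorted_mod_steps (T : Type) (e : rel T) (f : nat -> T) c d :
  (forall a, a < d -> e (f a) (f ((a + c) %% d))) ->
  sorted e [seq f (j * c %% d) | j <- iota 0 d].
Proof.
move=> he; apply/(sortedP (f 0)) => i; rewrite size_map size_iota => hi.
rewrite !(nth_map 0) ?size_iota ?nth_iota; try lia.
by rewrite !add0n mulSn addnC -modnDml; apply: he; rewrite ltn_mod; lia.
Qed.

(** As [c] is invertible modulo [d], equal residues of [i * c] and [j * c] force [d] to divide
    [j - i], which is below [d]. *)
Lemma uniq_mod_steps (T : eqType) (f : nat -> T) c d : coprime c d ->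
  {in gtn d &, injective f} -> uniq [seq f (j * c %% d) | j <- iota 0 d].
Proof.
move=> cd finj; rewrite map_inj_in_uniq ?iota_uniq // => i j.
rewrite !mem_iota !add0n /= => hi hj; have d0 : 0 < d by exact: leq_ltn_trans hi.
move/finj; rewrite !inE !ltn_mod => /(_ d0 d0) /eqP.
wlog le_ij : i j hi hj / i <= j.
  by move=> H; case: (leqP i j) => [|/ltnW] hij e; [|apply/esym]; apply: H => //; rewrite eq_sym.
rewrite eq_sym eqn_mod_dvd ?leq_mul2r ?le_ij ?orbT // -mulnBl Gauss_dvdl; last by rewrite coprime_sym.
move/dvdnP=> [q hq]; have : q = 0 by nia.
by move=> q0; move: hq; rewrite q0; lia.
Qed.

(* With K = k - 1, two vertices of a red path of vertices v_i at distance K are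
   forced to be blue. Let M be the largest number congruent to -2 modulo K that
   does not exceed the length of the path. If all pairs v_u, v_(u+M-K) with u < K
   are blue, then the steps of length K modulo M decompose into one blue path on the
   even indices and one on the odd ones. Otherwise a red pair closes a red cycle of
   length M - K + 1, which is prime to K, and the steps of length K around that
   cycle form a single blue path. *)
Lemma recolor_path h G2 m s R : sorted (has_color s red) R -> uniq R ->
  3 * h.*2.+2 <= size R ->
  (forall s' X Y, ext s s' ->
     sorted (has_color s' blue) X -> sorted (has_color s' blue) Y ->
     uniq (X ++ Y) -> {subset X ++ Y <= R} ->
     size R <= size X + size Y + 2 * h.*2.+2 ->
     builder_wins (cycle_graph h.*2.+3) G2 m s') ->
  builder_wins (cycle_graph h.*2.+3) G2 (h.*2.+2 + size R + m) s.
Proof.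
move=> hR uR lR hw; set K := h.*2.+2 in lR hw *.
pose v i := nth 0 R i.
have vinj : {in gtn (size R) &, injective v}.
  by move=> i j hi hj /eqP; rewrite nth_uniq // => /eqP.
have vmem i : i < size R -> v i \in R by exact: mem_nth.
have vneq i j : i < size R -> j < size R -> i != j -> v i != v j.
  by move=> hi hj; rewrite nth_uniq.
have K0 : 0 < K by [].
pose p := (size R).+2 %/ K.
have pK : p * K <= (size R).+2 by rewrite leq_divM.
have pK' : (size R).+2 < p.+1 * K by rewrite ltn_ceil.
have p3 : 3 <= p by rewrite leq_divRL //; clear -lR; lia.
(* [M + 2 = p * K], and [M] is even because [K] is. *)
pose half := p * h.+1 - 1; pose M := half.*2.
have p_half : p * h.+1 = half.+1 by rewrite /half; clear -p3; nia.
have eK : K = h.+1.*2 by [].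
have MK : M + 2 = p * K by rewrite eK -muln2 mulnA p_half /M; clear; lia.
have hM : M <= size R by clear -pK MK; lia.
have hM' : size R < M + K by clear -pK' MK; rewrite mulSn in pK'; lia.
have h_half : h.+1 < half by clear -p_half p3; nia.
have M2K : 2 * K <= M + 1 by clear -MK p3 K0; nia.
have {}hR s' i : ext s s' -> i.+1 < size R -> has_color s' red (v i) (v i.+1).
  by move=> hs' hi; apply: (ext_color hs'); apply: (sortedP 0 hR).
pose T1 := [seq (v u, v (u + (M - K))) | u <- iota 0 K].
have -> : K + size R + m = size T1 + (size R + m).
  by rewrite size_map size_iota addnA.
apply: builder_wins_reveal => [|s1 hs1 hT1].
  apply/allP => _ /mapP[u + ->] /=; rewrite mem_iota => hu.
  by apply: vneq; clear -hu hM M2K h_half eK; lia.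
have wrap u : u < K -> selected s1 (v u) (v (u + (M - K))).
  by move=> hu; apply: hT1; apply: (map_f (fun u => (v u, v (u + (M - K))))); rewrite mem_iota.
have [/hasP[u] | /hasPn hblue] :=
    boolP (has (fun u => has_color s1 red (v u) (v (u + (M - K)))) (iota 0 K)).
  rewrite mem_iota => /andP[_ hu] hred; rewrite add0n in hu.
  pose M1 := (M - K).+1; pose g a := v (u + a).
  have M1K : K < M1 by clear -M2K h_half eK MK p3; rewrite /M1; nia.
  have uM1 a : a < M1 -> u + a < size R by clear -hu hM M2K; rewrite /M1; lia.
  have ginj : {in gtn M1 &, injective g}.
    move=> a b ha hb /vinj; rewrite !inE => /(_ (uM1 _ ha) (uM1 _ hb)) /eqP.
    by rewrite eqn_add2l => /eqP.
  have modM1 a : a %% M1 < M1 by rewrite ltn_mod.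
  pose T2 := [seq (g a, g ((a + K) %% M1)) | a <- iota 0 M1].
  have leT2 : size T2 + m <= size R + m.
    by rewrite size_map size_iota leq_add2r /M1; clear -hM K0 M2K h_half eK; lia.
  apply: (builder_wins_ext (ext_refl s1) leT2).
  apply: builder_wins_reveal => [|s2 hs2 hT2].
    apply/allP => _ /mapP[a + ->] /=; rewrite mem_iota add0n => /= ha.
    apply/eqP => /ginj; rewrite !inE => /(_ ha (modM1 _)) /eqP.
    by rewrite -{1}(modn_small ha) -{1}[a]addn0 eqn_modDl mod0n modn_small.
  have hs12 := ext_trans hs1 hs2.
  apply: builder_wins_classic => hover.
  have redg t : t < M1 -> has_color s2 red (g t) (g (t.+1 %% M1)).
    rewrite leq_eqVlt => /orP[/eqP eqt | lt_t].
      have -> : t = M - K by case: eqt.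
      by rewrite modnn /g addn0 has_colorC; exact: ext_color hs2 _ _ _ hred.
    rewrite modn_small // /g addnS; apply: hR => //.
    by have := uM1 _ lt_t; rewrite addnS.
  have blueK a : a < M1 -> has_color s2 blue (g a) (g ((a + K) %% M1)).
    move=> ha; have : selected s2 (g a) (g ((a + K) %% M1)).
      by apply: hT2; apply: (map_f (fun a => (g a, g ((a + K) %% M1)))); rewrite mem_iota.
    case/orP=> // hr; case: hover.
    apply: (@red_chord_over K G2 s2 (fun i => g ((a + i) %% M1))).
    - move=> i _; have -> : (a + i.+1) %% M1 = ((a + i) %% M1).+1 %% M1.
        by rewrite addnS -[_.+1 in RHS]addn1 modnDml addn1.
      exact: redg.
    - by rewrite addn0 [a %% M1]modn_small // has_colorC.
    move=> i j; rewrite !inE => hi hj /ginj; rewrite !inE => /(_ (modM1 _) (modM1 _)) /eqP.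
    rewrite eqn_modDl !modn_small; first by move/eqP.
      exact: leq_ltn_trans M1K.
    exact: leq_ltn_trans M1K.
  (* [K] divides [M1 + 1]. *)
  have cop : coprime K M1.
    have e1 : p.-1 * K = M1.+1 by clear -MK p3 M2K; rewrite /M1; nia.
    by have := coprimenS M1; rewrite -e1 coprimeMr coprime_sym => /andP[_]; rewrite coprime_sym.
  apply: (hw s2 [seq g (j * K %% M1) | j <- iota 0 M1] [::]) => //.
  - exact: sorted_mod_steps.
  - by rewrite cats0; exact: uniq_mod_steps.
  - by rewrite cats0 => _ /mapP[j _ ->]; apply: vmem; exact: uM1.
  by rewrite size_map size_iota /M1; clear -hM' M2K; lia.
have {}wrap u : u < K -> has_color s1 blue (v u) (v (u + (M - K))).
  move=> hu; case/orP: (wrap u hu) => // hr.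
  by have := hblue u; rewrite mem_iota hr => /(_ hu).
pose T2 := [seq (v a, v (a + K)) | a <- iota 0 (M - K)].
have leT2 : size T2 + m <= size R + m.
  by rewrite size_map size_iota leq_add2r; clear -hM; lia.
apply: (builder_wins_ext (ext_refl s1) leT2).
apply: builder_wins_reveal => [|s2 hs2 hT2].
  apply/allP => _ /mapP[a + ->] /=; rewrite mem_iota add0n => /= ha.
  by apply: vneq; clear -ha hM K0; lia.
have hs12 := ext_trans hs1 hs2.
apply: builder_wins_classic => hover.
have blueK a : a + K < M -> has_color s2 blue (v a) (v (a + K)).
  move=> ha; have : selected s2 (v a) (v (a + K)).
    apply: hT2; apply: (map_f (fun a => (v a, v (a + K)))).
    by rewrite mem_iota; clear -ha; lia.
  case/orP=> // hr; case: hover.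
  apply: (@red_chord_over K G2 s2 (fun i => v (a + i))).
  - by move=> i hi; rewrite addnS; apply: hR => //; clear -hi ha hM; lia.
  - by rewrite addn0 has_colorC.
  move=> i j; rewrite !inE => hi hj /vinj; rewrite !inE => e; apply/eqP.
  by rewrite -(eqn_add2l a); apply/eqP/e; clear -hi hj ha hM; lia.
(* On the indices of parity [b], a step of [K] modulo [M] is a step of [h + 1] modulo [half]. A step
   that wraps around is one of the pairs at distance [M - K], read backwards. *)
have step b a : b < 2 -> a < half ->
    has_color s2 blue (v (b + a.*2)) (v (b + ((a + h.+1) %% half).*2)).
  move=> hb ha; have [lt_a | ge_a] := ltnP (a + h.+1) half.
    rewrite modn_small // doubleD addnA -eK; apply: blueK.
    by rewrite eK /M; clear -hb lt_a; lia.
  have -> : (a + h.+1) %% half = a + h.+1 - half.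
    by rewrite -[in LHS](subnK ge_a) modnDr modn_small //; clear -ha h_half; lia.
  have -> : b + a.*2 = b + (a + h.+1 - half).*2 + (M - K).
    by rewrite eK /M; clear -ge_a h_half; lia.
  rewrite has_colorC; apply: (ext_color hs2); apply: wrap.
  by rewrite eK; clear -hb ha ge_a; lia.
have cop : coprime h.+1 half.
  by have := coprimenS half; rewrite -p_half coprimeMr coprime_sym => /andP[_]; rewrite coprime_sym.
pose Z b := [seq v (b + (j * h.+1 %% half).*2) | j <- iota 0 half].
have lt_Z b a : b < 2 -> a < half -> b + a.*2 < size R.
  by move=> hb ha; apply: leq_trans hM; rewrite /M; clear -hb ha; lia.
have half0 : 0 < half by exact: leq_trans h_half.
have memZ b w : b < 2 -> w \in Z b -> w \in R.
  by move=> hb /mapP[j _ ->]; apply: vmem; apply: lt_Z; rewrite ?ltn_mod.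
have uZ b : b < 2 -> uniq (Z b).
  move=> hb; apply: (@uniq_mod_steps _ (fun a => v (b + a.*2))) => // i j hi hj /vinj.
  rewrite !inE => /(_ (lt_Z _ _ hb hi) (lt_Z _ _ hb hj)) /eqP.
  by rewrite eqn_add2l => /eqP; exact: double_inj.
apply: (hw s2 (Z 0) (Z 1)) => //.
- by apply: (@sorted_mod_steps _ _ (fun a => v (0 + a.*2))) => a; exact: step.
- by apply: (@sorted_mod_steps _ _ (fun a => v (1 + a.*2))) => a; exact: step.
- rewrite cat_uniq !uZ //= andbT; apply/hasPn => w /mapP[j _ ->].
  apply/mapP => -[i _ /vinj]; rewrite !inE => /(_ (lt_Z _ _ _ _) (lt_Z _ _ _ _)).
  rewrite !ltn_mod half0 => /(_ isT isT isT isT) /(congr1 odd).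
  by rewrite !oddD !odd_double.
- by move=> w; rewrite mem_cat => /orP[] /memZ ->.
by rewrite !size_map !size_iota; clear -hM' M2K; rewrite /M in hM' *; lia.
Qed.

(** * The strategy *)

(** Paths left over after a triangle may violate [ladder_state]. A [B0] of three or more vertices
    meets its last clause; a shorter one is dropped, losing at most 2, hence 10 instead of 8. An
    empty [B1] is replaced by a fresh vertex. *)
Lemma ladder_restart n G1 (T : nat) F s0 : 3 * n + 2 < T ->
  (forall m s B0 B1 x y z, ext s0 s ->
     sorted (has_color s blue) B0 -> sorted (has_color s blue) B1 ->
     uniq ([:: x; y; z] ++ B0 ++ B1 ++ F) ->
     has_color s red x y -> has_color s red y z -> has_color s red x z ->
     T <= m + size B0 + 2 * size B1 + 10 -> builder_wins G1 (path_graph n) m s) ->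
  forall m s B0 B1, ext s0 s ->
     sorted (has_color s blue) B0 -> sorted (has_color s blue) B1 ->
     uniq (B0 ++ B1 ++ F) -> T <= m + size B0 + 2 * size B1 ->
     builder_wins G1 (path_graph n) m s.
Proof.
move=> hT htri m s B0 B1 hs h0 h1 hu hm.
have {htri} start B0' B1' : ladder_state s B0' B1' ->
    sorted (has_color s blue) B0' -> sorted (has_color s blue) B1' ->
    uniq (B0' ++ B1' ++ F) -> T - 2 <= m + size B0' + 2 * size B1' ->
    builder_wins G1 (path_graph n) m s.
  move=> st h0' h1' hu' hm'; have hT' : 3 * n < T - 2 by clear -hT; lia.
  apply: (ladder hT' _ hs st h0' h1' hu' hm') => m' s' C0 C1 x y z hs' *.
  by apply: (htri m' s' C0 C1 x y z) => //; size_lia.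
have {}start B1' : 0 < size B1' -> sorted (has_color s blue) B1' ->
    uniq (B0 ++ B1' ++ F) -> size B1 <= size B1' ->
    builder_wins G1 (path_graph n) m s.
  move=> hB1 h1' hu' le1; have [lt0 | ge0] := ltnP 2 (size B0).
    apply: (start B0 B1') => //; last by clear -hm le1; lia.
    case: B0 lt0 {h0 hu hm hu'} => [//|e0 B0] lt0.
    by case: B1' hB1 {h1' le1} => [//|e1 B1'] _; constructor 3.
  apply: (start [::] B1') => //; last by clear -hm le1 ge0; size_lia.
    by case: B1' hB1 {h1' hu' le1}.
  by uniq_from hu'.
case: B1 => [|e1 B1] in h1 hu hm start *; last exact: (start (e1 :: B1)).
have [v hv] := fresh_vertex (B0 ++ F).
have huv : uniq (v :: B0 ++ F) by rewrite cons_uniq hv.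
by apply: (start [:: v]) => //; uniq_from huv.
Qed.

(** A red triangle and a red path with room for all probes, in one list so that it fits into the
    common [uniq] condition. *)
Definition joiner h (s : position) (J : seq nat) : Prop :=
  exists x y z Q, J = [:: x; y; z] ++ Q /\
    [/\ has_color s red x y, has_color s red y z, has_color s red x z,
        sorted (has_color s red) Q & 6 * h + 2 <= size Q].

Lemma joiner_ext h s s' J : ext s s' -> joiner h s J -> joiner h s' J.
Proof.
move=> hs [x [y [z [Q [-> [xy yz xz hQ sQ]]]]]]; exists x, y, z, Q; split=> //.
by split=> //; try exact: ext_color hs _ _ _ _; exact: sorted_ext hQ.
Qed.

(** [F] holds vertices reserved for later joins, which the new path avoids. *)
Lemma join_with h G2 m s P0 P1 J F : 0 < h -> joiner h s J ->
  sorted (has_color s blue) P0 -> sorted (has_color s blue) P1 ->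
  uniq (P0 ++ P1 ++ J ++ F) ->
  (forall s' P, ext s s' -> sorted (has_color s' blue) P -> uniq (P ++ F) ->
     size P0 + size P1 <= size P ->
     builder_wins (cycle_graph h.*2.+3) G2 m s') ->
  builder_wins (cycle_graph h.*2.+3) G2 (12 * h + 14 + m) s.
Proof.
move=> h0 [x [y [z [Q [-> [xy yz xz hQ sQ]]]]]] h1 h2 hu hw.
apply: (join_paths h0 h1 h2 hQ sQ _ xy yz xz); first by uniq_from hu.
move=> s' P hs' hP uP subP leP; apply: (hw s' P) => //.
apply: uniq_count_le hu => a; have := count_sub a uP subP.
by rewrite !count_cat /=; clear; lia.
Qed.

Lemma endgame h n m s B0 B1 J1 J2 J3 : 0 < h ->
  joiner h s J1 -> joiner h s J2 -> joiner h s J3 ->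
  sorted (has_color s blue) B0 -> sorted (has_color s blue) B1 ->
  uniq (B0 ++ B1 ++ J1 ++ J2 ++ J3) ->
  3 * n + 56 * h + 65 <= m + size B0 + 2 * size B1 ->
  builder_wins (cycle_graph h.*2.+3) (path_graph n) m s.
Proof.
move=> h0 j1 j2 j3 hB0 hB1 hu hm.
apply: builder_wins_classic => hover.
have ltn_path P : sorted (has_color s blue) P -> uniq P -> size P < n.
  move=> hP uP; rewrite ltnNge; apply/negP => h'; apply: hover.
  exact: (@blue_path_over n _ s P).
have lt0 : size B0 < n by apply: ltn_path => //; uniq_from hu.
have lt1 : size B1 < n by apply: ltn_path => //; uniq_from hu.
have finish m' s' C : ext s s' -> sorted (has_color s' blue) C ->
    uniq (B0 ++ C ++ J1 ++ J2 ++ J3) -> n <= size B0 + size C ->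
    12 * h + 14 <= m' -> builder_wins (cycle_graph h.*2.+3) (path_graph n) m' s'.
  move=> hs' hC hu' hn hm'; rewrite -(subnKC hm').
  apply: (join_with (F := [::]) h0 (joiner_ext hs' j1) (sorted_ext hs' hB0) hC).
    by uniq_from hu'.
  move=> s2 P hs2 hP; rewrite cats0 => uP leP; apply: builder_wins_over.
  by apply: (@blue_path_over n _ s2 P) => //; exact: leq_trans leP.
have [ge_n | lt_n] := leqP n (size B0 + size B1).
  by apply: (finish m s B1) => //; clear -hm lt0 lt1; lia.
have [v hv] := fresh_vertex (B0 ++ B1 ++ J1 ++ J2 ++ J3).
have huv : uniq (v :: B0 ++ B1 ++ J1 ++ J2 ++ J3) by rewrite cons_uniq hv.
have [w hw] := fresh_vertex (v :: B0 ++ B1 ++ J1 ++ J2 ++ J3).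
have huw : uniq (w :: v :: B0 ++ B1 ++ J1 ++ J2 ++ J3) by rewrite cons_uniq hw.
(* If the red path stays below [3 * K], the blue paths already hold [n] vertices; otherwise
   recolouring loses at most [2 * K]. The constant is [3 * (n + 3 * K + 1) + K + 3 * (12 * h + 14)]:
   two rounds per raced vertex, one per recoloured vertex plus [K], and three joins. *)
pose K := h.*2.+2; pose N := n + 3 * K - size B0.
pose T' := 3 * n + 56 * h + 65 - 2 * size B0.
have race C : sorted (has_color s blue) C -> uniq (C ++ [:: v] ++ B0 ++ J1 ++ J2 ++ J3) ->
    0 < size C -> size B1 <= size C <= (size B1).+1 ->
    builder_wins (cycle_graph h.*2.+3) (path_graph n) m s.
  move=> hC huC C0 sC.
  apply: (@path_race _ _ T' N N (B0 ++ J1 ++ J2 ++ J3) s _ _ m s C [:: v]) => //.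
  - by rewrite /T' /N /K; clear -lt0; lia.
  - move=> m' s' B R hs' hB hR hu' _ leN geN hm'.
    have {}geN : N <= size B + size R by case: geN => // geN; clear -geN; lia.
    have [ltR | geR] := ltnP (size R) (3 * K).
      apply: (finish m' s' B) => //; first by uniq_from hu'.
        by clear -ltR geN; rewrite /N in geN; lia.
      by clear -hm' leN lt0; rewrite /T' /N /K in hm' leN; lia.
    have le_m' : K + size R + (3 * (12 * h + 14)) <= m'.
      by clear -hm' leN lt0; rewrite /T' /N /K in hm' leN *; lia.
    apply: (builder_wins_ext (ext_refl s') le_m').
    apply: (recolor_path hR) => //; first by uniq_from hu'.
    move=> s1 X Y hs1 hX hY uXY subXY leXY.
    have huXY : uniq (B ++ (X ++ Y) ++ B0 ++ J1 ++ J2 ++ J3).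
      apply: uniq_count_le hu' => a; have := count_sub a uXY subXY.
      by rewrite !count_cat => le; rewrite leq_add2l leq_add2r.
    have hs01 := ext_trans hs' hs1.
    have -> : 3 * (12 * h + 14) = 12 * h + 14 + (12 * h + 14 + (12 * h + 14 + 0)).
      by clear; lia.
    apply: (join_with (F := X ++ Y ++ J2 ++ J3) h0 (joiner_ext hs01 j1)
      (sorted_ext hs01 hB0) (sorted_ext hs1 hB)); first by uniq_from huXY.
    move=> s2 P1 hs2 hP1 u1 le1; have hs02 := ext_trans hs01 hs2.
    apply: (join_with (F := Y ++ J3) h0 (joiner_ext hs02 j2) hP1
      (sorted_ext hs2 hX)); first by uniq_from u1.
    move=> s3 P2 hs3 hP2 u2 le2; have hs03 := ext_trans hs02 hs3.
    apply: (join_with (F := [::]) h0 (joiner_ext hs03 j3) hP2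
      (sorted_ext (ext_trans hs2 hs3) hY)); first by uniq_from u2.
    move=> s4 P3 hs4 hP3 u3 le3; apply: builder_wins_over.
    apply: (@blue_path_over n _ s4 P3) => //; first by uniq_from u3.
    by clear -le1 le2 le3 leXY geN; rewrite /N /K in geN *; lia.
  - by clear -lt_n sC; rewrite /N /K /=; lia.
  by clear -hm sC; rewrite /T' /=; lia.
case: B1 => [|b B1] in hB1 hu hm lt1 lt_n v hv huv w hw huw race finish *.
  by apply: (race [:: w]) => //; uniq_from huw.
by apply: (race (b :: B1)); rewrite ?leqnn ?leqnSn //; uniq_from huv.
Qed.

Theorem theorem3 (n k : nat) (hn : 0 < n) (hk : 3 <= k) (hodd : odd k) :
  exists2 r : nat, is_online_ramsey (cycle_graph k) (path_graph n) r &
    r <= 3 * n + 50 * k.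
Proof.
apply: online_ramsey_le.
have [h ->] : exists h, k = h.*2.+3.
  by exists (k./2.-1); have := odd_double_half k; rewrite hodd; clear -hk; lia.
case: (posnP h) => [-> | h0].
  (* For [k = 3] a red triangle ends the game, so one ladder suffices. *)
  apply: (@ladder n _ (3 * n).+1 [::] [::] _ _ _ [::] [::] [:: 0]) => //; last by size_lia.
  move=> m s B0 B1 x y z _ _ _ hu xy yz xz _; apply: builder_wins_over.
  apply: (@red_cycle_over _ _ _ [:: x; y; z]) => //; first by uniq_from hu.
  by rewrite /= xy yz has_colorC xz.
(* Each of the three joiners needs a red path of [q] vertices. As the blue path stays below [n], the
   bound [n + L] on the total also forces [L] red vertices. *)
pose q := 6 * h + 2; pose L := 3 * q.
apply: (@path_race _ _ (3 * n + 50 * h.*2.+3) L (n + L) [::] [::] _ _ _ [::] [:: 0] [:: 1]) => //;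
  try by rewrite /= /L /q; clear -hn; lia.
move=> m s B R _ hB hR hu leR _ hstop hm.
apply: builder_wins_classic => hover.
have ltB : size B < n.
  rewrite ltnNge; apply/negP => le_n; apply: hover.
  by apply: (@blue_path_over n _ s B) => //; uniq_from hu.
have {hstop}geR : L <= size R by case: hstop => // ge; clear -ge ltB; lia.
pose Q1 := take q R; pose Q2 := take q (drop q R); pose Q3 := drop q (drop q R).
have eR : R = Q1 ++ Q2 ++ Q3 by rewrite !cat_take_drop.
have sQ1 : q <= size Q1 by rewrite size_takel //; clear -geR; rewrite /L in geR; lia.
have sQ2 : q <= size Q2.
  by rewrite size_takel // size_drop; clear -geR; rewrite /L in geR; lia.
have sQ3 : q <= size Q3 by rewrite !size_drop; clear -geR; rewrite /L in geR; lia.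
have hQ1 : sorted (has_color s red) Q1 by exact: take_sorted.
have hQ2 : sorted (has_color s red) Q2 by apply: take_sorted; exact: drop_sorted.
have hQ3 : sorted (has_color s red) Q3 by do 2! apply: drop_sorted.
rewrite {1}eR {eR hR geR} in hu; clearbody Q1 Q2 Q3.
(* The red path has at most [18 * h + 7] vertices, at two rounds each. Each of the three triangles
   then costs at most 10, leaving [64 * h + 100] where [endgame] asks for [56 * h + 65]. *)
have {}hm : 3 * n + 64 * h + 130 <= m + 2 * size B.
  by clear -hm leR; rewrite /L /q in leR; lia.
apply: (@ladder_restart n _ (3 * n + 64 * h + 130) (Q1 ++ Q2 ++ Q3) s _ _ m s [::] B) => //;
  try (by clear -hm; size_lia); last by uniq_from hu.
move=> {B hB hu hm ltB hover leR} m1 s1 B0 B1 x1 y1 z1 hs1 hB0 hB1 hu xy1 yz1 xz1 hm.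
pose J1 := [:: x1; y1; z1] ++ Q1.
have j1 : joiner h s1 J1.
  by exists x1, y1, z1, Q1; split=> //; split=> //; exact: sorted_ext hQ1.
have {}hu : uniq (B0 ++ B1 ++ J1 ++ Q2 ++ Q3) by uniq_from hu.
clearbody J1.
apply: (@ladder_restart n _ (3 * n + 64 * h + 120) (J1 ++ Q2 ++ Q3) s1 _ _ m1 s1 B0 B1) => //;
  try by clear -hm; lia.
move=> {B0 B1 hB0 hB1 hu hm} m2 s2 B0 B1 x2 y2 z2 hs2 hB0 hB1 hu xy2 yz2 xz2 hm.
have hs02 := ext_trans hs1 hs2.
pose J2 := [:: x2; y2; z2] ++ Q2.
have j2 : joiner h s2 J2.
  by exists x2, y2, z2, Q2; split=> //; split=> //; exact: sorted_ext hQ2.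
have {}hu : uniq (B0 ++ B1 ++ J1 ++ J2 ++ Q3) by uniq_from hu.
clearbody J2.
apply: (@ladder_restart n _ (3 * n + 64 * h + 110) (J1 ++ J2 ++ Q3) s2 _ _ m2 s2 B0 B1) => //;
  try by clear -hm; lia.
move=> {B0 B1 hB0 hB1 hu hm} m3 s3 B0 B1 x3 y3 z3 hs3 hB0 hB1 hu xy3 yz3 xz3 hm.
pose J3 := [:: x3; y3; z3] ++ Q3.
have j3 : joiner h s3 J3.
  by exists x3, y3, z3, Q3; split=> //; split=> //; exact: sorted_ext (ext_trans hs02 hs3) hQ3.
have {}hu : uniq (B0 ++ B1 ++ J1 ++ J2 ++ J3) by uniq_from hu.
apply: (endgame h0 (joiner_ext (ext_trans hs2 hs3) j1) (joiner_ext hs3 j2) j3 hB0 hB1 hu).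
by clear -hm; lia.
Qed.
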